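(* Let $(X,\tau)$ be a metrizable space, let $a\in X$, and fix a metric $d$ on $X$ compatible with $\tau$ such that $d\le1$. For $s\in\mathcal G_a(\tau)$, define $$\rho_s(x,y)=|s(x)-s(y)|+\min\{s(x),s(y)\}\,d(x,y)\qquad(x,y\in X).$$ Then for every $s\in\mathcal G_a(\tau)$, $\rho_s$ is a metric on $X$ whose topology $\tau_s$ lies in $\mathcal L^m_a(\tau)$, and the family $\{\{x\in X:s(x)<\varepsilon\}:\varepsilon>0\}$ is a neighborhood base at $a$ for $\tau_s$. Every member of $\mathcal L^m_a(\tau)$ is equal to $\tau_s$ for some $s\in\mathcal G_a(\tau)$. Moreover, for all $s,t\in\mathcal G_a(\tau)$, $$\tau_s\subseteq\tau_t\quad\Longleftrightarrow\quad\forall\varepsilon>0\ \exists\delta>0:\ \{x\in X: t(x)<\delta\}\subseteq\{x\in X: s(x)<\varepsilon\}.$$ The topology $\tau_s$ is independent of the choice of the compatible metric $d\le1$. If $d$ is complete, then $\rho_s$ is complete for every $s\in\mathcal G_a(\tau)$.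
   Context: $X$ is a nonempty set. A metric is compatible with a topology if it induces it. $\mathcal G_a(\tau)$ denotes the set of functions $s:X\to[0,\infty)$ that are $\tau$-continuous and satisfy $s^{-1}(0)=\{a\}$. $\mathcal L^m_a(\tau)$ denotes the set of all metrizable topologies $\sigma$ on $X$ such that $\sigma\subseteq\tau$ and $\sigma|_{X\setminus\{a\}}=\tau|_{X\setminus\{a\}}$ (equality of subspace topologies). *)

(* Defs.v *)
From HB Require Import structures.
From mathcomp Require Import all_boot all_order all_algebra.
From mathcomp Require Import all_classical all_reals all_analysis.

Set Implicit Arguments.
Unset Strict Implicit.
Unset Printing Implicit Defensive.

Import Order.TTheory GRing.Theory Num.Theory.
Import numFieldNormedType.Exports.

Local Open Scope classical_set_scope.
Local Open Scope ring_scope.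

(* Several topologies and metrics live on the same carrier here, so a topology
   other than the ambient one is given by its family of open sets, and a metric
   by its distance function; [metric_topology_mdist] and [is_metric_Metric]
   relate this to the structure [metricType]. *)

Section metrics.
Context {R : realType} {X : Type}.
Implicit Types rho : X -> X -> R.

Record is_metric rho : Prop := IsMetric {
  metric_ge0 : forall x y, 0 <= rho x y ;
  metric_eq0 : forall x y, rho x y = 0 <-> x = y ;
  metric_symmetric : forall x y, rho x y = rho y x ;
  metric_triangular : forall x y z, rho x z <= rho x y + rho y z
}.

Definition metric_ball rho (x : X) (e : R) : set X := [set y | rho x y < e].

Definition metric_topology rho : set_system X :=
  [set U | forall x, U x -> exists2 e : R, 0 < e & metric_ball rho x e `<=` U].

Definition metric_cauchy rho (u : nat -> X) : Prop :=
  forall e : R, 0 < e -> \forall m & n \near \oo, rho (u m) (u n) < e.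

Definition metric_complete rho : Prop :=
  forall u : nat -> X, metric_cauchy rho u ->
    exists l : X, rho (u n) l @[n --> \oo] --> (0 : R).

End metrics.

Section topologies.
Context {X : Type}.
Implicit Types sigma : set_system X.

Definition metrizable (R : realType) sigma : Prop :=
  exists2 rho : X -> X -> R, is_metric rho & sigma = metric_topology rho.

(* The open sets of the subspace [A], seen as subsets of [X]. *)
Definition subspace_opens sigma (A : set X) : set_system X :=
  [set U `&` A | U in sigma].

(* Neighborhoods need not be open. *)
Definition nbhs_base sigma (x : X) (B : set_system X) : Prop :=
  B `<=` nbhs_of_open sigma x /\
  forall U, nbhs_of_open sigma x U -> exists2 V, B V & V `<=` U.

End topologies.

Section ambient.
Context {R : realType} {X : topologicalType}.
Implicit Types (a : X) (s : X -> R) (d : X -> X -> R).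

Definition compatible d : Prop := metric_topology d = @open X.

Definition calG a : set (X -> R) :=
  [set s : X -> R | [/\ forall x, 0 <= s x,
                        continuous s
                      & s @^-1` [set 0] = [set a]]].

Definition rho_ d s (x y : X) : R :=
  `|s x - s y| + Num.min (s x) (s y) * d x y.

Definition tau_ d s : set_system X := metric_topology (rho_ d s).

Definition sublevel s (e : R) : set X := [set x | s x < e].

End ambient.

Definition calLm (R : realType) (X : topologicalType) (a : X) :
    set (set_system X) :=
  [set sigma | [/\ metrizable R sigma,
                   sigma `<=` @open X
                 & subspace_opens sigma (~` [set a]) =
                   subspace_opens (@open X) (~` [set a])]].

Section library.
Context {R : realType}.

Lemma is_metric_mdist (M : metricType R) : is_metric (@mdist R M).
Proof.
split; [exact: mdist_ge0 | | exact: metric_sym |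
  by move=> x y z; exact: metric_triangle].
by move=> x y; split=> [/mdist_positivity //|->]; exact: mdistxx.
Qed.

Lemma metric_topology_mdist (M : metricType R) :
  metric_topology (@mdist R M) = @open M.
Proof.
have ballE : metric_ball (@mdist R M) = @ball R M.
  by apply/funext => x; apply/funext => e; rewrite ballEmdist.
rewrite /metric_topology ballE openE; apply/seteqP; split=> U HU x /HU.
- by move=> [e e0 eU]; apply/nbhs_ballP; exists e.
- by move=> /nbhs_ballP[e e0 eU]; exists e.
Qed.

Lemma is_metric_Metric (X : choiceType) (rho : X -> X -> R) :
  is_metric rho -> exists m : Metric R X, @mdist R (Metric.Pack m) = rho.
Proof.
case: X rho => X cX rho [_ rho0 rhoC rhoD].
have rhoxx x : rho x x = 0 by exact/rho0.
have rho_eq x y : rho x y = 0 -> x = y by move/rho0.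
have rhoD' y x z : rho x z <= rho x y + rho y z by exact: rhoD.
pose C := isMetric.Build R (Choice.Pack cX) rhoxx rho_eq rhoC rhoD'.
pose M : metricType R := HB.pack X cX C.
by exists (Metric.class M).
Qed.

End library.

(* Main.v *)
Require Import Defs.
From mathcomp Require Import all_boot all_order all_algebra.
From mathcomp Require Import all_classical all_reals all_analysis.
From mathcomp Require Import lra.

(** The proof rests on one description of the topology of [rho_ d s]
    ([tau_E]): a set [U] belongs to [tau_ d s] exactly when it is open in the
    ambient topology and, if it contains [a], it contains some sublevel set
    [sublevel s e] with [e > 0].

    This holds because [rho_ d s a y = s y], so that the balls at [a] are the
    sublevel sets, whereas near a point [x <> a] the weight [min (s x) (s y)]
    stays between [s x / 2] and [s x], so that [rho_ d s x] controls, and is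
    controlled by, [d x] together with the continuous function [s].

    As [d] does not occur in this description, [tau_ d s] does not depend on
    [d]; it coarsens the ambient topology at [a] only, and sublevel sets form a
    base at [a].  The inclusion of [tau_ d s] in [tau_ d t] is the comparison of
    sublevel sets, since [sublevel s e] is itself in [tau_ d s].  Conversely a
    metric [r] inducing a coarser topology that agrees with the ambient one off
    [a] induces [tau_ d s] for [s := r a], as its own topology admits the same
    description ([metric_topologyE]).

    For completeness, [s] sends a [rho_ d s]-Cauchy sequence to a convergent
    one.  If the limit is [0], the sequence tends to [a]; otherwise the weight
    is eventually bounded away from [0], the sequence is Cauchy for [d], and its
    [d]-limit is also its limit for [rho_ d s]. *)

Set Implicit Arguments.
Unset Strict Implicit.
Unset Printing Implicit Defensive.

Import Order.TTheory GRing.Theory Num.Theory.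
Import numFieldNormedType.Exports.

Local Open Scope classical_set_scope.
Local Open Scope ring_scope.

(** * Topologies induced by a metric *)

Section metric_facts.
Context {R : realType}.

Lemma metric_xx {X : Type} (r : X -> X -> R) (x : X) :
  is_metric r -> r x x = 0.
Proof. by case=> _ r0 _ _; exact/r0. Qed.

Lemma metric_topology_ball {X : Type} (r : X -> X -> R) (x : X) (e : R) :
  is_metric r -> metric_topology r (metric_ball r x e).
Proof.
move=> [_ _ _ rD] y; rewrite /metric_ball /= => xye.
exists (e - r x y); first by rewrite subr_gt0.
by move=> z /=; have := rD x y z; lra.
Qed.

Lemma metric_topology_setC1 {X : Type} (r : X -> X -> R) (a : X) :
  is_metric r -> metric_topology r (~` [set a]).
Proof.
move=> [r_ge0 r0 _ _] x /= xa; exists (r x a).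
  by rewrite lt0r r_ge0 andbT; apply/eqP => /r0.
by move=> y; rewrite /metric_ball /= => + ya; rewrite ya ltxx.
Qed.

Lemma compatible_nbhsP {X : topologicalType} (d : X -> X -> R) (x : X)
    (A : set X) : is_metric d -> compatible d ->
  nbhs x A <-> exists2 e : R, 0 < e & metric_ball d x e `<=` A.
Proof.
move=> dm dc; split.
  rewrite nbhsE => -[U [+ Ux] UA].
  rewrite -dc => /(_ x Ux)[e e0 eU]; exists e => //.
  exact: subset_trans UA.
move=> [e e0 eA]; rewrite nbhsE; exists (metric_ball d x e) => //.
split; last by rewrite /metric_ball /= metric_xx.
by rewrite -dc; exact: metric_topology_ball.
Qed.

Lemma compatible_setC1_open {X : topologicalType} (d : X -> X -> R) (a : X) :
  is_metric d -> compatible d -> open (~` [set a]).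
Proof. by move=> dm <-; exact: metric_topology_setC1. Qed.

(** The reverse triangle inequality makes [r a] continuous for [r], hence for
    every finer topology. *)
Lemma metric_continuous {X : topologicalType} (r : X -> X -> R) (a : X) :
  is_metric r -> metric_topology r `<=` @open X -> continuous (r a).
Proof.
move=> rm rX x; have [_ _ rC rD] := rm.
apply/cvgrPdist_lt => e e0.
have : nbhs x (metric_ball r x e).
  apply: open_nbhs_nbhs; split; first exact/rX/metric_topology_ball.
  by rewrite /metric_ball /= metric_xx.
apply: filterS => y; rewrite /metric_ball /= => xye; rewrite ltr_distl.
have := rD a x y; have := rD a y x; rewrite (rC y x); lra.
Qed.

(** At a point [x] of [U] other than [a], the trace of [U] off [a] is also the
    trace of some [V] open for [r], and an [r]-ball at [x] contained in [V] and
    small enough to miss [a] lies in [U]; only the neighborhoods of [a] can tell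
    the two topologies apart. *)
Lemma metric_topologyE {X : topologicalType} (r : X -> X -> R) (a : X) :
  is_metric r -> metric_topology r `<=` @open X ->
  subspace_opens (metric_topology r) (~` [set a]) =
    subspace_opens (@open X) (~` [set a]) ->
  metric_topology r =
    [set U | open U /\
      (U a -> exists2 e : R, 0 < e & sublevel (r a) e `<=` U)].
Proof.
move=> rm rX rsub; apply/seteqP; split=> U.
  by move=> rU; split; [exact: rX | exact: rU].
move=> [oU aU] x Ux; have [xa|xa] := pselect (x = a).
  by subst x; exact: aU.
have : subspace_opens (@open X) (~` [set a]) (U `&` ~` [set a]) by exists U.
rewrite -rsub => -[V rV VU].
have Vx : V x.
  by have : (U `&` ~` [set a]) x by []; rewrite -VU => -[].
have [e e0 eV] := rV x Vx.
have [e' e'0 e'a] := metric_topology_setC1 rm xa.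
exists (Num.min e e'); first by rewrite lt_min e0.
move=> y; rewrite /metric_ball /= lt_min => /andP[ye ye'].
have : (V `&` ~` [set a]) y by split; [exact: eV | exact: e'a].
by rewrite VU => -[].
Qed.

End metric_facts.

(** * The metric rho_s *)

Section rho.
Context {R : realType} {X : topologicalType}.
Implicit Types (a : X) (s t : X -> R) (d : X -> X -> R).

Lemma calG_eq0 a s x : calG a s -> s x = 0 <-> x = a.
Proof.
move=> [_ _ sa]; split=> [sx|->].
  by have : (s @^-1` [set 0]) x by []; rewrite sa.
by have : (s @^-1` [set 0]) a by rewrite sa.
Qed.

Lemma calG_gt0 a s x : calG a s -> x <> a -> 0 < s x.
Proof.
move=> sG xa; have [s0 _ _] := sG.
by rewrite lt0r s0 andbT; apply/eqP => /(calG_eq0 _ sG).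
Qed.

(** When [s y] lies below both [s x] and [s z], passing through [y] costs
    [2 * (min (s x) (s z) - s y)] more in the variation of [s], and this pays
    for the drop of the weight because [d <= 1]. *)
Lemma rho_triangle d s x y z : is_metric d -> (forall x y, d x y <= 1) ->
  (forall x, 0 <= s x) -> rho_ d s x z <= rho_ d s x y + rho_ d s y z.
Proof.
move=> [d0 _ _ dD] d1 s0; rewrite /rho_.
set m := Num.min (s x) (s z).
have m0 : 0 <= m by rewrite le_min !s0.
have [mx mz] : m <= s x /\ m <= s z by rewrite /m !ge_min !lexx orbT.
have [my|ym] := leP m (s y).
  have weighted u v (p : R) : m <= p -> m * d u v <= p * d u v.
    by move=> mp; exact: ler_wpM2r.
  have h1 : m * d x y <= Num.min (s x) (s y) * d x y.
    by apply: weighted; rewrite le_min mx.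
  have h2 : m * d y z <= Num.min (s y) (s z) * d y z.
    by apply: weighted; rewrite le_min mz andbT.
  have h3 : m * d x z <= m * d x y + m * d y z.
    by rewrite -mulrDr; exact: ler_wpM2l.
  have := ler_distD (s y) (s x) (s z); lra.
have [yx yz] : s y < s x /\ s y < s z by split; lra.
rewrite (min_r (ltW yx)) (min_l (ltW yz)).
rewrite (gtr0_norm (x := s x - s y)) ?subr_gt0//.
rewrite (ltr0_norm (x := s y - s z)) ?subr_lt0//.
have h1 : (m - s y) * d x z <= m - s y by rewrite ler_piMr// subr_ge0 ltW.
have h2 : s y * d x z <= s y * d x y + s y * d y z.
  by rewrite -mulrDr; exact: ler_wpM2l.
have h3 : `|s x - s z| + m = s x + s z - m.
  by rewrite /m; case: (leP (s x) (s z)) => ?;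
    [rewrite ler0_norm | rewrite gtr0_norm]; lra.
lra.
Qed.

Lemma rho_is_metric a d s : is_metric d -> (forall x y, d x y <= 1) ->
  calG a s -> is_metric (rho_ d s).
Proof.
move=> dm d1 sG; have [s0 _ _] := sG; have [d0 deq0 dC _] := dm.
have md0 x y : 0 <= Num.min (s x) (s y) * d x y.
  by rewrite mulr_ge0// le_min !s0.
split; rewrite /rho_.
- by move=> x y; rewrite addr_ge0.
- move=> x y; split=> [/eqP|->]; last first.
    by rewrite (metric_xx y dm) subrr normr0 mulr0 addr0.
  rewrite paddr_eq0// normr_eq0 subr_eq0 => /andP[/eqP sxy].
  rewrite sxy minxx mulf_eq0 => /orP[/eqP sy0|/eqP/deq0//].
  have /(calG_eq0 _ sG) -> := sy0.
  by apply/(calG_eq0 _ sG); rewrite sxy.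
- by move=> x y; rewrite distrC minC dC.
- by move=> x y z; exact: rho_triangle.
Qed.

Lemma rho_center a d s y : calG a s -> rho_ d s a y = s y.
Proof.
move=> sG; have [s0 _ _] := sG.
have /(calG_eq0 _ sG) sa0 := erefl a.
by rewrite /rho_ sa0 (min_l (s0 y)) mul0r addr0 sub0r normrN ger0_norm.
Qed.

Lemma rho_le d s x y : is_metric d ->
  rho_ d s x y <= `|s x - s y| + s x * d x y.
Proof.
by case=> d0 _ _ _; rewrite /rho_ lerD2l ler_wpM2r// ge_min lexx.
Qed.

Lemma dist_le_rho d s x y : is_metric d -> (forall x, 0 <= s x) ->
  `|s x - s y| <= rho_ d s x y.
Proof.
by case=> d0 _ _ _ s0; rewrite /rho_ lerDl mulr_ge0// le_min !s0.
Qed.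

Lemma weighted_le_rho d s (c : R) x y : is_metric d -> c <= s x -> c <= s y ->
  c * d x y <= rho_ d s x y.
Proof.
move=> [d0 _ _ _] cx cy; apply: (@le_trans _ _ (Num.min (s x) (s y) * d x y)).
  by rewrite ler_wpM2r// le_min cx.
by rewrite /rho_ lerDr.
Qed.

(** * The topology of rho_s *)

Lemma tau_sub_open d s : is_metric d -> compatible d -> (forall x, 0 <= s x) ->
  continuous s -> tau_ d s `<=` @open X.
Proof.
move=> dm dc s0 sc U tU; rewrite -dc => x /tU[e e0 eU].
have e20 : 0 < e / 2 by rewrite divr_gt0.
have /cvgrPdist_lt/(_ _ e20)/(compatible_nbhsP _ _ dm dc)[k k0 kP] := sc x.
have sx1 : 0 < s x + 1 by rewrite ltr_wpDl.
exists (Num.min k (e / 2 / (s x + 1))); first by rewrite lt_min k0 divr_gt0.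
move=> y; rewrite /metric_ball /= lt_min => /andP[yk ye]; apply: eU.
rewrite /metric_ball /=; apply: le_lt_trans (rho_le _ _ _ dm) _.
have := kP y yk; rewrite /= => sxy.
rewrite ltr_pdivlMr// in ye.
have [d0 _ _ _] := dm; have := d0 x y; lra.
Qed.

(** Off [a] the [rho_ d s]-ball of radius at most [s x / 2] keeps [s] above
    [s x / 2], whence [d x y < 2 * rho_ d s x y / s x] there. *)
Lemma tau_E a d s : is_metric d -> compatible d -> calG a s ->
  tau_ d s = [set U | open U /\
    (U a -> exists2 e : R, 0 < e & sublevel s e `<=` U)].
Proof.
move=> dm dc sG; have [s0 sc _] := sG.
have aball e : metric_ball (rho_ d s) a e = sublevel s e.
  by apply/seteqP; split=> y; rewrite /metric_ball /sublevel /= (rho_center _ _ sG).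
apply/seteqP; split=> U.
  move=> tU; split; first exact: (tau_sub_open dm dc s0 sc).
  by move=> /tU[e e0]; rewrite aball => eU; exists e.
move=> [+ aU] x Ux; rewrite -dc => /(_ x Ux)[e e0 eU].
have [xa|xa] := pselect (x = a).
  subst x; have [k k0 kU] := aU Ux.
  by exists k => //; rewrite aball.
have sx2 : 0 < s x / 2 by rewrite divr_gt0// (calG_gt0 sG).
exists (Num.min (s x / 2) (s x / 2 * e)).
  by rewrite lt_min sx2 mulr_gt0.
move=> y; rewrite /metric_ball /= lt_min => /andP[y1 y2]; apply: eU.
rewrite /metric_ball /= -(ltr_pM2l sx2); apply: le_lt_trans y2.
apply: weighted_le_rho => //; first by lra.
have := dist_le_rho x y dm s0; have := ler_norm (s x - s y); lra.
Qed.

Lemma sublevel_tau a d s (e : R) : is_metric d -> compatible d -> calG a s ->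
  0 < e -> tau_ d s (sublevel s e).
Proof.
move=> dm dc sG e0; rewrite (tau_E dm dc sG); split; last by exists e.
have [_ sc _] := sG.
by apply: (@open_comp _ _ s [set y | y < e]) => [x _|]; [exact: sc | exact: open_lt].
Qed.

Lemma tau_calLm a d s : is_metric d -> compatible d ->
  (forall x y, d x y <= 1) -> calG a s -> calLm R a (tau_ d s).
Proof.
move=> dm dc d1 sG; split.
- by exists (rho_ d s) => //; exact: rho_is_metric sG.
- by rewrite (tau_E dm dc sG) => U [].
rewrite (tau_E dm dc sG); apply/seteqP; split=> W [U].
  by move=> [oU _] <-; exists U.
(* [U] need not be in [tau_ d s], but it has the trace of [U \ {a}], which is. *)
move=> oU <-; exists (U `&` ~` [set a]); last by rewrite -setIA setIid.
split; last by case=> _ /(_ erefl).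
by apply: openI => //; exact: compatible_setC1_open dm dc.
Qed.

Lemma tau_nbhs_base a d s : is_metric d -> compatible d -> calG a s ->
  nbhs_base (tau_ d s) a [set sublevel s e | e in [set e : R | 0 < e]].
Proof.
move=> dm dc sG; split=> U.
  move=> [e /= e0 <-]; exists (sublevel s e); split => //.
    exact: sublevel_tau sG e0.
  by have /(calG_eq0 _ sG) sa0 := erefl a; rewrite /sublevel /= sa0.
move=> [V [+ Va VU]]; rewrite (tau_E dm dc sG) => -[_ /(_ Va)[e e0 eV]].
exists (sublevel s e); last exact: subset_trans VU.
by exists e.
Qed.

Lemma calLm_tau a d sigma : is_metric d -> compatible d -> calLm R a sigma ->
  exists2 s, calG a s & sigma = tau_ d s.
Proof.
move=> dm dc [[r rm ->] rX rsub]; have [r_ge0 r0 _ _] := rm.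
have rG : calG a (r a).
  split=> //; first exact: metric_continuous.
  by apply/seteqP; split=> x /= => [/r0//|->]; exact: metric_xx.
by exists (r a) => //; rewrite (tau_E dm dc rG) -metric_topologyE.
Qed.

Lemma tau_subP a d s t : is_metric d -> compatible d -> calG a s -> calG a t ->
  tau_ d s `<=` tau_ d t <->
  forall e : R, 0 < e ->
    exists2 delta : R, 0 < delta & sublevel t delta `<=` sublevel s e.
Proof.
move=> dm dc sG tG; split.
  move=> + e e0 => /(_ _ (sublevel_tau dm dc sG e0)).
  rewrite (tau_E dm dc tG) => -[_]; apply.
  by have /(calG_eq0 _ sG) sa0 := erefl a; rewrite /sublevel /= sa0.
move=> st U; rewrite (tau_E dm dc sG) (tau_E dm dc tG) => -[oU aU].
split=> // /aU[e /st[k k0 ks] eU]; exists k => //.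
exact: subset_trans eU.
Qed.

(** * Completeness *)

Lemma rho_cauchy_cvg d s (u : nat -> X) : is_metric d ->
  (forall x, 0 <= s x) -> metric_cauchy (rho_ d s) u ->
  cvg (s (u n) @[n --> \oo]).
Proof.
move=> dm s0 uc; apply/cauchy_cvgP/cauchy_exP => e e0.
have [[A B] /= [oA oB] AB] := uc e e0.
have [m Am] := filter_ex oA.
exists (s (u m)); apply: (filterS _ oB) => n Bn.
rewrite -ball_normE /=; apply: le_lt_trans (dist_le_rho _ _ dm s0) _.
exact: (AB (m, n)).
Qed.

(** A lower bound [c] on [s] along the sequence bounds the weight in [rho_ d s]
    from below, so that [c * d] is dominated by [rho_ d s]. *)
Lemma rho_cauchy_away d s (u : nat -> X) (c : R) : is_metric d -> 0 < c ->
  (\forall n \near \oo, c <= s (u n)) ->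
  metric_cauchy (rho_ d s) u -> metric_cauchy d u.
Proof.
move=> dm c0 cu uc e e0.
have [[A B] /= [oA oB] AB] := uc (c * e) (mulr_gt0 c0 e0).
exists ([set n | A n /\ c <= s (u n)], [set n | B n /\ c <= s (u n)]).
  by split; apply: filterI.
move=> [m n] /= [[Am cm] [Bn cn]].
rewrite -(ltr_pM2l c0); apply: le_lt_trans (weighted_le_rho dm cm cn) _.
exact: (AB (m, n)).
Qed.

(** The limit is reached by squeezing: [rho_ d s l x] is at most
    [`|s l - s x| + s l * d l x], and both terms vanish as [x] tends to [l]. *)
Lemma rho_cvg d s (u : nat -> X) (l : X) : is_metric d -> compatible d ->
  (forall x, 0 <= s x) -> continuous s ->
  d (u n) l @[n --> \oo] --> (0 : R) ->
  rho_ d s (u n) l @[n --> \oo] --> (0 : R).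
Proof.
move=> dm dc s0 sc dl; have [d0 _ dC _] := dm.
have ul : u n @[n --> \oo] --> l.
  move=> A /(compatible_nbhsP _ _ dm dc)[e e0 eA].
  have /cvgrPdist_lt/(_ _ e0) := dl; apply: filterS => n.
  by rewrite sub0r normrN ger0_norm// dC => ?; exact: eA.
have sl : s (u n) @[n --> \oo] --> s l by exact: cvg_comp ul (sc l).
have upper : `|s l - s (u n)| + s l * d (u n) l @[n --> \oo] --> (0 : R).
  rewrite -[X in _ --> X](_ : `|s l - s l| + s l * 0 = 0); last first.
    by rewrite subrr normr0 mulr0 addr0.
  apply: cvgD; last exact: cvgMr.
  by apply: cvg_norm; apply: cvgB => //; exact: cvg_cst.
apply: (squeeze_cvgr _ (cvg_cst (0 : R)) upper).
apply: nearW => n; apply/andP; split.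
  by rewrite /rho_ addr_ge0// mulr_ge0// le_min !s0.
rewrite (_ : rho_ d s (u n) l = rho_ d s l (u n)); last first.
  by rewrite /rho_ distrC minC dC.
by rewrite (dC (u n)); exact: rho_le.
Qed.

Lemma rho_complete a d s : is_metric d -> compatible d ->
  (forall x y, d x y <= 1) -> metric_complete d -> calG a s ->
  metric_complete (rho_ d s).
Proof.
move=> dm dc d1 dcomplete sG u uc; have [s0 sc _] := sG.
have [_ _ rhoC _] := rho_is_metric dm d1 sG.
have /cvg_ex[c /= suc] := rho_cauchy_cvg dm s0 uc.
have c_ge0 : 0 <= c.
  by apply: (cvgr_to_ge suc); exact: nearW.
have [c0|c0] := eqVneq c 0.
  exists a; rewrite c0 in suc; apply: cvg_trans suc; apply: near_eq_cvg.
  by apply: nearW => n; rewrite rhoC (rho_center _ _ sG).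
have c2 : 0 < c / 2 by rewrite divr_gt0// lt0r c0.
have cu : \forall n \near \oo, c / 2 <= s (u n).
  by apply: (cvgr_ge c) => //; lra.
have [l dl] := dcomplete u (rho_cauchy_away dm c2 cu uc).
by exists l; exact: rho_cvg.
Qed.

End rho.

(** * The correspondence between functions and topologies *)

Theorem theorem1p2 (R : realType) (X : topologicalType) (a : X)
    (d : X -> X -> R) (d_metric : is_metric d) (d_compatible : compatible d)
    (d_le1 : forall x y, d x y <= 1) :
  [/\ forall s, calG a s ->
        [/\ is_metric (rho_ d s),
            calLm R a (tau_ d s)
          & nbhs_base (tau_ d s) a
              [set sublevel s e | e in [set e : R | 0 < e]]],
      forall sigma, calLm R a sigma -> exists2 s, calG a s & sigma = tau_ d s,
      forall s t, calG a s -> calG a t ->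
        tau_ d s `<=` tau_ d t <->
        forall e : R, 0 < e ->
          exists2 delta : R, 0 < delta & sublevel t delta `<=` sublevel s e,
      forall d' : X -> X -> R, is_metric d' -> compatible d' ->
        (forall x y, d' x y <= 1) ->
        forall s, calG a s -> tau_ d' s = tau_ d s
    & metric_complete d -> forall s, calG a s -> metric_complete (rho_ d s)].
Proof.
split.
- move=> s sG; split; first exact: rho_is_metric sG.
  + exact: tau_calLm.
  + exact: tau_nbhs_base.
- by move=> sigma; exact: calLm_tau.
- by move=> s t; exact: tau_subP.
- move=> d' d'm d'c _ s sG.
  by rewrite (tau_E d'm d'c sG) (tau_E d_metric d_compatible sG).
- by move=> dcomplete s sG; exact: rho_complete sG.
Qed.
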